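(* Any embedding $\mathbb{R}^2 \to \mathbb{R}^5$, $\mathbb{R}^4 \to \mathbb{R}^{11}$, or $\mathbb{R}^8 \to \mathbb{R}^{23}$ inscribes a trapezoid or maps three distinct points to a line.
   Context: Embedding means topological embedding (in particular continuous and injective). A map $f\colon\mathbb{R}^d\to\mathbb{R}^n$ inscribes a trapezoid if its image contains the four vertices of a trapezoid, i.e. there are four pairwise distinct points $u_1,v_1,u_2,v_2\in f(\mathbb{R}^d)$, no three of them collinear, and reals $t_1,t_2>0$ with $t_1(u_1-v_1)=t_2(u_2-v_2)$ (parallelograms count as trapezoids). The map $f$ maps three distinct points to a line if there are three distinct points of $\mathbb{R}^d$ whose images under $f$ lie on a common affine line. *)

(* Defs.v *)
(* R^n is 'rV[R]_n for an arbitrary R : realType, with the product topology. *)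
From HB Require Import structures.
From mathcomp Require Import all_boot all_order all_algebra.
From mathcomp Require Import all_classical all_reals all_analysis.
Export numFieldNormedType.Exports.

Set Implicit Arguments.
Unset Strict Implicit.
Unset Printing Implicit Defensive.

Import Order.TTheory GRing.Theory Num.Theory.
Local Open Scope classical_set_scope.
Local Open Scope ring_scope.

(* The last clause says that f is open as a map onto its image: a set is open
   in [subspace (range f)] iff its trace on [range f] is relatively open. *)
Definition embedding (T U : topologicalType) (f : T -> U) : Prop :=
  [/\ continuous f, injective f &
      forall A : set T, open A -> open (f @` A : set (subspace (range f)))].

Section Trapezoids.
Context {R : realType} {n : nat}.
Implicit Types (x y z u v w : 'rV[R]_n) (L : set 'rV[R]_n).

Definition affine_line L : Prop :=
  exists p w, w != 0 /\ L = [set p + t *: w | t in [set: R]].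

Definition collinear x y z : Prop :=
  exists L, affine_line L /\ [/\ L x, L y & L z].

Definition trapezoid u1 v1 u2 v2 : Prop :=
  [/\ uniq [:: u1; v1; u2; v2],
      [/\ ~ collinear u1 v1 u2, ~ collinear u1 v1 v2,
          ~ collinear u1 u2 v2 & ~ collinear v1 u2 v2] &
      exists t1 t2 : R,
        [/\ 0 < t1, 0 < t2 & t1 *: (u1 - v1) = t2 *: (u2 - v2)]].

Definition inscribes_trapezoid (d : nat) (f : 'rV[R]_d -> 'rV[R]_n) : Prop :=
  exists u1 v1 u2 v2,
    [/\ range f u1, range f v1, range f u2 & range f v2] /\
    trapezoid u1 v1 u2 v2.

Definition maps_three_points_to_line (d : nat) (f : 'rV[R]_d -> 'rV[R]_n) :
    Prop :=
  exists x y z : 'rV[R]_d,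
    uniq [:: x; y; z] /\ collinear (f x) (f y) (f z).

End Trapezoids.

(* Main.v *)
Require Import Defs.
From mathcomp Require Import all_boot all_order all_algebra.
From mathcomp Require Import all_classical all_reals all_analysis.
From mathcomp Require Import ring lra zify.

(* Suppose f inscribes no trapezoid and sends no three points to a line. Then
   f p - f q and f p' - f q' are linearly independent for distinct pairs
   {p, q} and {p', q'}. Using a division algebra structure on R^d, to
   x = (a, u, v) in R^(1+2d) and w in R^d \ 0 attach the pairs with centres u, -u
   and half-differences (1 + |Re v|) w + v w and (1 + |Re v|) w - v w; they
   coincide only for u = v = 0. If G+, G- are the corresponding differences of
   values of f, then F(x, w) = a (G+ + G-) + (G+ - G-) has no zero with x, w <> 0,
   and is odd in x and in w separately. No such map
   S^(2d) x S^(d-1) -> R^(3d-1) exists, as 'C(3d-1, 2d) is odd for d = 2, 4, 8.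

   The last point is proved mod 2 on chains of tuples of points. Let b_ij be the
   pair (i-th pole, j-th pole) and let T1, T2 be the two antipodes. The chains
   E_ij = b_ij * ((1 + T1) E_(i-1)j + (1 + T2) E_i(j-1)) satisfy
   dE_ij = (1 + T1) E_(i-1)j + (1 + T2) E_i(j-1). For functions g_1, .., g_k to
   Z/2 that change value under T1 and T2, the cup product of the cocycles dg_l is
   the coboundary of h = g_k (dg_(k-1) u .. u dg_1), and both 1 + T1 and 1 + T2 take
   h to dg_(k-1) u .. u dg_1; hence its value on E_ij, or on any subdivision,
   obeys Pascal's rule and equals 'C(i + j, i). Taking for g_l the sign of the l-th
   coordinate of F, arbitrarily small simplices exist on which all coordinates
   change sign, and compactness gives a zero. *)

Set Implicit Arguments.
Unset Strict Implicit.
Unset Printing Implicit Defensive.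
Import Order.TTheory GRing.Theory Num.Def Num.Theory.

Lemma odd_bin_23_16 : odd 'C(23, 16).
Proof.
(* Unary evaluation of 'C(23, 7) = 245157 is not an option. *)
rewrite -[16]/(23 - 7) (bin_sub (isT : 7 <= 23)); have CS := mul_bin_left 23.
(* Abstracting the function leaves C 0 = 1 and (k + 1) C (k + 1) = (23 - k) C k for k <= 6, linear
   relations that determine C 7. *)
move: (binomial 23) (bin0 23) CS => C C0 CS.
move: (CS 0) (CS 1) (CS 2) (CS 3) (CS 4) (CS 5) (CS 6); rewrite C0.
lia.
Qed.

(** * Mod 2 cochains *)

Section Cochains.
Context {P : eqType}.
Implicit Types (psi phi : seq P -> bool) (s t : seq P) (T : P -> P).

(* Adjoint to the augmented boundary: [::] is a face of [:: v]. *)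
Fixpoint cobd psi s : bool :=
  if s is v :: t then psi t (+) cobd (fun u => psi (v :: u)) t else false.

(** Adjoint to 1 + T on mod 2 chains. *)
Definition twist T psi : seq P -> bool := fun s => psi s (+) psi (map T s).

(** Cup product of the 0-cochain g with psi. *)
Definition lead (g : P -> bool) psi s : bool :=
  if s is v :: _ then g v && psi s else false.

Lemma eq_in_cobd psi phi s :
  (forall t, (size t).+1 = size s -> psi t = phi t) -> cobd psi s = cobd phi s.
Proof.
elim: s psi phi => //= v s IH psi phi e; rewrite e //; congr (_ (+) _).
by apply: IH => t st; rewrite e //= st.
Qed.

Lemma cobdD psi phi s :
  cobd (fun t => psi t (+) phi t) s = cobd psi s (+) cobd phi s.
Proof. by elim: s psi phi => //= v s IH psi phi; rewrite IH addbACA. Qed.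

Lemma cobd_andl c psi s : cobd (fun t => c && psi t) s = c && cobd psi s.
Proof. by elim: s psi => /= [|v s IH] psi; rewrite ?andbF // IH andb_addr. Qed.

Lemma cobd0 s : cobd (fun=> false) s = false.
Proof. by elim: s => //= v s ->. Qed.

Lemma cobdK psi s : cobd (cobd psi) s = false.
Proof. by elim: s psi => //= v s IH psi; rewrite cobdD IH addbF addbb. Qed.

Lemma cobd_map T psi s : cobd psi (map T s) = cobd (psi \o map T) s.
Proof. by elim: s psi => //= v s IH psi; rewrite IH. Qed.

Lemma cobd_ex psi s : cobd psi s ->
  exists t, [/\ psi t, (size t).+1 = size s & {subset t <= s}].
Proof.
elim: s psi => //= v s IH psi; have [ps _|_ /IH[t [pt st sub]]] := boolP (psi s).
  by exists s; split => // x xs; rewrite inE xs orbT.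
exists (v :: t); split => //=; first by rewrite st.
by move=> x; rewrite !inE => /orP[->//|/sub ->]; rewrite orbT.
Qed.

(** * Cup products of coboundaries of functions *)

Section Cup.
Variable g : nat -> P -> bool.

(* cup k is dg_(k-1) u .. u dg_0, see cup_cons2. *)
Fixpoint cup k : seq P -> bool :=
  if k is k'.+1 then cobd (lead (g k') (cup k')) else fun s => size s == 1%N.

Lemma cup_cocycle k s : cobd (cup k) s = false.
Proof. by case: k => [|k]; [case: s => [|v [|w [|x s]]] //=; rewrite cobd0|exact: cobdK]. Qed.

Lemma cup_nil k : cup k [::] = false.
Proof. by case: k. Qed.

(** The faces that keep v contribute g_k(v) times the sum of [cup k] over them; as [cup k] is a
    cocycle, this sum is its value on the face without v. *)
Lemma cup_cons2 k v w s :
  cup k.+1 [:: v, w & s] = (g k v (+) g k w) && cup k (w :: s).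
Proof.
have := cup_cocycle k [:: v, w & s]; rewrite /=.
set X := cobd _ s => e.
rewrite (cobd_andl (g k v)) -/X.
by move: e; case: (g k v); case: (g k w); case: (cup k _); case: (cup k _); case: X.
Qed.

(** By [cup_cons2], a nonzero value forces each g_l in turn to change between consecutive vertices.
    This converts a parity count into sign changes. *)
Lemma cup_change k s : cup k s -> forall l, (l < k)%N ->
  exists p q, [/\ p \in s, q \in s & g l p != g l q].
Proof.
elim: k s => // k IH [|v [|w s]]; rewrite ?cup_cons2 //= ?cup_nil //.
case/andP => gvw /IH{}IH l; rewrite ltnS leq_eqVlt => /orP[/eqP ->|/IH].
  by exists v, w; rewrite !inE !eqxx orbT; split => //; case: (g k v) gvw; case: (g k w).
move=> [p [q [pw qw pq]]]; exists p, q; split => //.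
  by rewrite inE pw orbT.
by rewrite inE qw orbT.
Qed.

(** The values of g_k at a point and its antipode add up to 1. *)
Lemma twist_lead T k : (forall l p, g l (T p) = ~~ g l p) ->
  (forall s, cup k (map T s) = cup k s) ->
  twist T (lead (g k) (cup k)) = cup k.
Proof.
move=> gT cT; apply/funext => -[|v s]; rewrite /twist /= ?cup_nil //.
by rewrite -map_cons cT gT; case: (g k v); case: (cup k _).
Qed.

(** Negating g_k adds [cup k] to the cochain whose coboundary is taken, and [cup k] is a cocycle. *)
Lemma cup_map T k s : (forall l p, g l (T p) = ~~ g l p) ->
  cup k (map T s) = cup k s.
Proof.
move=> gT; elim: k s => [|k IH] s; first by rewrite /= size_map.
rewrite [LHS]cobd_map -[RHS]addbF -(cup_cocycle k s) -cobdD.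
apply: eq_in_cobd => t _ /=.
by rewrite -[cup k t](congr1 (@^~ t) (twist_lead gT IH)) /twist addKb.
Qed.

End Cup.

(** * Subdivision as an operator on cochains *)

Section Subdivision.
Variable bar : seq P -> P.

(* Adjoint to barycentric subdivision: a simplex s is subdivided by coning the
   subdivision of its boundary from bar s. The fuel n is meant to be size s. *)
Fixpoint subdiv n psi s : bool :=
  if n is n'.+1 then cobd (subdiv n' (fun t => psi (bar s :: t))) s
  else psi [::].

Definition sd psi s := subdiv (size s) psi s.

Lemma subdivD n psi phi s :
  subdiv n (fun t => psi t (+) phi t) s = subdiv n psi s (+) subdiv n phi s.
Proof.
elim: n psi phi s => //= n IH psi phi s; rewrite -cobdD.
by apply: eq_in_cobd => t _; rewrite IH.
Qed.

Lemma sdE psi s : s != [::] -> sd psi s = cobd (sd (fun t => psi (bar s :: t))) s.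
Proof.
rewrite /sd; case: s => // v s _; rewrite [size _]/= [LHS]/=.
by apply: (@eq_in_cobd _ _ (v :: s)) => t [->].
Qed.

Lemma sdD psi phi s : sd (fun t => psi t (+) phi t) s = sd psi s (+) sd phi s.
Proof. exact: subdivD. Qed.

(** On a cone the coboundary of psi splits into psi on the base and the coboundary of psi (b :: _).
    By induction on faces the latter contributes a double coboundary, which vanishes. *)
Lemma sd_cobd psi s : sd (cobd psi) s = cobd (sd psi) s.
Proof.
have [n] := ubnP (size s); elim: n psi s => // n IH psi [//|v s'] sn.
set s := v :: s' in sn *; rewrite sdE //.
rewrite (eq_in_cobd (phi := fun t => sd psi t (+)
   cobd (sd (fun u => psi (bar s :: u))) t)).
  by rewrite cobdD cobdK addbF.
move=> t st; rewrite -IH; last by rewrite st.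
exact: sdD.
Qed.

Lemma iter_sd_cobd m psi : iter m sd (cobd psi) = cobd (iter m sd psi).
Proof. by elim: m => //= m ->; apply/funext => s; rewrite sd_cobd. Qed.

Lemma iter_sdD m psi phi : iter m sd (fun t => psi t (+) phi t) =
  (fun t => iter m sd psi t (+) iter m sd phi t).
Proof. by elim: m => //= m ->; apply/funext => s; rewrite sdD. Qed.

Lemma sd_map T : (forall s, s != [::] -> bar (map T s) = T (bar s)) ->
  forall psi s, sd psi (map T s) = sd (psi \o map T) s.
Proof.
move=> barT psi s; have [n] := ubnP (size s).
elim: n psi s => // n IH psi [//|v s'] sn.
set s := v :: s' in sn *; rewrite sdE // sdE // cobd_map barT //.
by apply: eq_in_cobd => t st /=; rewrite IH // st.
Qed.

Lemma iter_sd_singleton m psi p :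
  (forall q, psi [:: q]) -> iter m sd psi [:: p].
Proof.
elim: m psi => // m IH psi psi1; rewrite iterSr; apply: IH => q.
by rewrite /sd /= addbF.
Qed.

Lemma iter_sd_map T : (forall s, s != [::] -> bar (map T s) = T (bar s)) ->
  forall m psi, iter m sd psi \o map T = iter m sd (psi \o map T).
Proof.
move=> barT; elim=> //= m IH psi; apply/funext => s /=.
by rewrite sd_map // IH.
Qed.

Lemma iter_sd_twist T : (forall s, s != [::] -> bar (map T s) = T (bar s)) ->
  forall m psi, twist T (iter m sd psi) = iter m sd (twist T psi).
Proof. by move=> barT m psi; rewrite /twist iter_sdD -iter_sd_map. Qed.

End Subdivision.

(** * The chains E_ij and their boundaries *)

Section Cells.
Variables (b : nat -> nat -> P) (T1 T2 : P -> P).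
Hypothesis T1K : involutive T1.
Hypothesis T2K : involutive T2.
Hypothesis T12 : forall p, T1 (T2 p) = T2 (T1 p).

Local Notation cone i j psi := (fun t => psi (b i j :: t)).

(* cell i j psi is the value of psi on the chain E_ij. *)
Fixpoint cell i : nat -> (seq P -> bool) -> bool :=
  if i is i'.+1 then
    fix celli j psi := cell i' j (twist T1 (cone i j psi)) (+)
      (if j is j'.+1 then celli j' (twist T2 (cone i j psi)) else false)
  else
    fix cell0 j psi :=
      if j is j'.+1 then cell0 j' (twist T2 (cone 0 j psi)) else psi [:: b 0 0].

(** Value of psi on (1 + T1) E_(i-1)j + (1 + T2) E_i(j-1), where terms of negative index are
    dropped. *)
Definition cell_bd i j psi : bool :=
  (if i is i'.+1 then cell i' j (twist T1 psi) else false) (+)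
  (if j is j'.+1 then cell i j' (twist T2 psi) else false).

Lemma cellE i j psi :
  cell i j psi = cell_bd i j (cone i j psi) (+)
    (if i + j is 0 then psi [:: b 0 0] else false).
Proof. by case: i j => [|i] [|j]; rewrite ?addnS /= /cell_bd /= ?addbF. Qed.

Arguments cell : simpl never.

Lemma twistD T psi phi : twist T (fun t => psi t (+) phi t) =
  (fun t => twist T psi t (+) twist T phi t).
Proof. by apply/funext => t; rewrite /twist addbACA. Qed.

Lemma cellD i j psi phi :
  cell i j (fun t => psi t (+) phi t) = cell i j psi (+) cell i j phi.
Proof.
elim: i j psi phi => [|i IHi]; elim=> [|j IHj] psi phi;
  rewrite !cellE /cell_bd ?addSn ?add0n //= ?addbF ?twistD ?IHi ?IHj //.
by rewrite addbACA.
Qed.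

Lemma cell_bdD i j psi phi : cell_bd i j (fun t => psi t (+) phi t) =
  cell_bd i j psi (+) cell_bd i j phi.
Proof.
by rewrite /cell_bd; case: i j => [|i] [|j]; rewrite ?twistD ?cellD ?addbF // addbACA.
Qed.

Lemma cell0 i j : cell i j (fun=> false) = false.
Proof. by rewrite -[RHS](addbb (cell i j (fun=> false))) -cellD. Qed.

Lemma twist_cobd T psi : twist T (cobd psi) = cobd (twist T psi).
Proof. by apply/funext => s; rewrite /twist cobd_map -cobdD. Qed.

Lemma twistK T psi : involutive T -> twist T (twist T psi) = fun=> false.
Proof.
move=> TK; apply/funext => s; rewrite /twist -map_comp.
by rewrite (@eq_map _ _ (T \o T) id) // map_id addbA addbK addbb.
Qed.

Lemma twistC psi : twist T1 (twist T2 psi) = twist T2 (twist T1 psi).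
Proof.
apply/funext => s; rewrite /twist addbACA -!map_comp; congr (_ (+) (_ (+) psi _)).
by apply: eq_map => p /=.
Qed.

(** The bases of the cones give [cell_bd]. What remains is the boundary of the boundary: squares of
    1 + T1 and 1 + T2 vanish mod 2, and the mixed terms cancel because T1 and T2 commute. The term
    at i = j = 0 is the empty face of a vertex. *)
Lemma cell_cobd i j psi :
  cell i j (cobd psi) = cell_bd i j psi (+) (if i + j is 0 then psi [::] else false).
Proof.
have [n] := ubnP (i + j); elim: n i j psi => // n IH i j psi ijn.
rewrite cellE.
have -> : cone i j (cobd psi) = (fun t => psi t (+) cobd (cone i j psi) t) by [].
rewrite cell_bdD -addbA; congr (_ (+) _).
set phi := cone i j psi.
case: i j phi ijn => [|i] [|j] phi ijn //.
- by rewrite /= addbF.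
- rewrite /cell_bd /= addbF twist_cobd IH // /cell_bd; case: (j) => [|j'] /=.
    exact: addbb.
  by rewrite addbF twistK // cell0.
- rewrite /cell_bd /= !addbF twist_cobd IH // /cell_bd; case: (i) => [|i'] /=.
    exact: addbb.
  by rewrite !addbF twistK // cell0.
- have ijn' : (i + j.+1 < n)%N by move: ijn; rewrite addSn.
  rewrite /cell_bd !twist_cobd IH // IH; last by rewrite addSn -addnS.
  rewrite /cell_bd !addnS addSn !addbF.
  have z1 T k l phi' : involutive T -> cell k l (twist T (twist T phi')) = false.
    by move=> TK; rewrite twistK ?cell0.
  rewrite twistC.
  by case: (i) (j) => [|i'] [|j']; rewrite ?z1 //= ?addbF ?addFb addbb.
Qed.

(** G is an invariant of the tuples that make up E_ij: it passes to the cone over a tuple and over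
    its antipodal image. *)
Lemma cell_ex (G : nat -> nat -> seq P -> Prop) :
  G 0%N 0%N [:: b 0 0] ->
  (forall i j s, G i j s -> G i.+1 j (b i.+1 j :: s) /\
                            G i.+1 j (b i.+1 j :: map T1 s)) ->
  (forall i j s, G i j s -> G i j.+1 (b i j.+1 :: s) /\
                            G i j.+1 (b i j.+1 :: map T2 s)) ->
  forall i j psi, cell i j psi -> exists2 s, G i j s & psi s.
Proof.
move=> G0 G1 G2.
have tw T (H H' : seq P -> Prop) c psi :
    (forall s, H s -> H' (c :: s) /\ H' (c :: map T s)) ->
    (exists2 s, H s & twist T (fun t => psi (c :: t)) s) ->
    exists2 s, H' s & psi s.
  move=> HH' [s /HH'[h1 h2]]; rewrite /twist.
  by have [?|_] := boolP (psi (c :: s)); [exists (c :: s)|exists (c :: map T s)].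
elim=> [|i IHi]; elim=> [|j IHj] psi.
- by exists [:: b 0 0].
- by rewrite cellE /cell_bd !addbF => /IHj; apply: tw; apply: G2.
- by rewrite cellE /cell_bd addSn !addbF => /IHi; apply: tw; apply: G1.
- rewrite cellE /cell_bd addSn addbF.
  have [/IHi h _|_ /IHj] := boolP (cell i _ _).
    by apply: tw h; apply: G1.
  by apply: tw; apply: G2.
Qed.

Section Count.
Variables (bar : seq P -> P) (g : nat -> P -> bool).
Hypothesis bar1 : forall s, s != [::] -> bar (map T1 s) = T1 (bar s).
Hypothesis bar2 : forall s, s != [::] -> bar (map T2 s) = T2 (bar s).
Hypothesis g1 : forall k p, g k (T1 p) = ~~ g k p.
Hypothesis g2 : forall k p, g k (T2 p) = ~~ g k p.

(** [cell_cobd] moves the outer coboundary onto the boundary of E_ij, where [twist_lead] leaves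
    [cup] of one degree less on E_(i-1)j and E_i(j-1): Pascal's rule. Subdivision commutes with each
    step. *)
Lemma cell_cup m i j :
  cell i j (iter m (sd bar) (cup g (i + j))) = odd 'C(i + j, i).
Proof.
have [n] := ubnP (i + j); elim: n i j => // n IH i j ijn.
case k: (i + j)%N => [|k'].
  case: i j k {ijn} => [|i] [|j] //= _; rewrite cellE /cell_bd /=.
  exact: iter_sd_singleton.
rewrite [cup _ _]/= iter_sd_cobd cell_cobd k addbF /cell_bd.
rewrite !iter_sd_twist // !twist_lead //; try by move=> s; rewrite cup_map.
have {}IH i' j' : (i' + j' = k')%N ->
    cell i' j' (iter m (sd bar) (cup g k')) = odd 'C(k', i').
  by move=> e; rewrite -e IH // e; rewrite k in ijn.
case: i j k ijn => [|i] [|j] // /eqP; rewrite ?addn0 ?addnS ?addSn eqSS => /eqP e _.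
- by rewrite (IH 0%N) // !bin0.
- by rewrite addbF IH ?addn0 // -e !binn.
- by rewrite !IH ?addnS // binS oddD addbC.
Qed.

End Count.
End Cells.
End Cochains.

Local Open Scope classical_set_scope.
Local Open Scope ring_scope.

(** * Barycentric subdivision *)

Definition convex_pred (R : numDomainType) (V : lmodType R) (C : V -> Prop) :=
  forall (a : R) x y, 0 <= a <= 1 -> C x -> C y -> C (a *: x + (1 - a) *: y).

(* Points carry a bit, flipped by the antipodes, which serves as the sign of a
   coordinate of F where that coordinate vanishes: in this way signs are equivariant
   at every point. *)
Section Barycenter.
Context {R : realType} {V : normedModType R}.
Implicit Types (s t : seq (V * bool)) (psi : seq (V * bool) -> bool).

(** With the bit of the first vertex, barycenters commute with antipodes that flip bits. *)
Definition barycenter s : V * bool :=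
  ((size s)%:R^-1 *: \sum_(p <- s) p.1, if s is p :: _ then p.2 else false).

Lemma barycenter_map (L : V -> V) s :
  L 0 = 0 -> {morph L : x y / x + y} -> (forall a, {morph L : x / a *: x}) ->
  s != [::] -> barycenter [seq (L p.1, ~~ p.2) | p <- s] =
               (L (barycenter s).1, ~~ (barycenter s).2).
Proof.
move=> L0 LD LZ; case: s => // p s _; rewrite /barycenter size_map LZ big_map.
by rewrite (big_morph L LD L0).
Qed.

Lemma barycenter_convex (C : V -> Prop) s : convex_pred C -> s != [::] ->
  (forall p, p \in s -> C p.1) -> C (barycenter s).1.
Proof.
move=> cC; case: s => // p s _; elim: s p => [|p' s IH] p Cs.
  by rewrite /= big_seq1 invr1 scale1r; apply: Cs; rewrite inE.
have /= := cC (size [:: p, p' & s])%:R^-1 p.1 (barycenter (p' :: s)).1.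
rewrite [\sum_(q <- [:: p, p' & s]) _]big_cons scalerDr scalerA.
set n := (size s).+1; have n0 : n%:R != 0 :> R by rewrite pnatr_eq0.
have n10 : n.+1%:R != 0 :> R by rewrite pnatr_eq0.
have -> : (1 - n.+1%:R^-1) * n%:R^-1 = n.+1%:R^-1 :> R.
  by move: n0 n10; rewrite -[n.+1%:R]natr1 => n0 n10; field; rewrite n0 n10.
apply.
- by rewrite invr_ge0 ler0n invf_le1 ?ltr0n // ler1n.
- by apply: Cs; rewrite inE eqxx.
- by apply: IH => q qs; apply: Cs; rewrite inE qs orbT.
Qed.

(** Among the k differences q - p that are averaged, the one with q = p is zero, which leaves the
    factor (k - 1) / k <= n / (n + 1). *)
Lemma barycenter_dist (D : R) n s p : (size s <= n.+1)%N -> 0 <= D -> p \in s ->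
  (forall q, q \in s -> `|q.1 - p.1| <= D) ->
  `|(barycenter s).1 - p.1| <= n%:R / n.+1%:R * D.
Proof.
move=> sn D0 ps pD; have s0 : (0 < size s)%N by case: (s) ps.
have e : (barycenter s).1 - p.1 = (size s)%:R^-1 *: \sum_(q <- s) (q.1 - p.1).
  rewrite sumrB scalerBr; congr (_ - _).
  rewrite big_const_seq count_predT iter_addr_0 -[p.1 *+ _]scaler_nat scalerA.
  rewrite mulVf ?scale1r //.
  by rewrite pnatr_eq0 -lt0n.
rewrite e normrZ ger0_norm ?invr_ge0 ?ler0n // (perm_big _ (perm_to_rem ps)) /=.
rewrite big_cons subrr add0r.
have : `|\sum_(q <- rem p s) (q.1 - p.1)| <= (size s).-1%:R * D.
  apply: le_trans (ler_norm_sum _ _ _) _.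
  rewrite -(size_rem ps); have : {in rem p s, forall q, `|q.1 - p.1| <= D}.
    by move=> q /mem_rem /pD.
  elim: (rem p s) => [|q u IH] uD; first by rewrite big_nil mul0r.
  rewrite big_cons /= -natr1 mulrDl mul1r addrC lerD //.
    by apply: IH => q' q'u; apply: uD; rewrite inE q'u orbT.
  by apply: uD; rewrite inE eqxx.
move=> h; apply: le_trans (ler_wpM2l _ h) _; first by rewrite invr_ge0.
rewrite mulrA ler_wpM2r // mulrC.
case: (size s) s0 sn => // k _ kn /=.
rewrite ler_pdivrMr ?ltr0n // mulrAC ler_pdivlMr ?ltr0n //.
by rewrite -!natrM ler_nat !mulnS [(n * k)%N]mulnC leq_add2r.
Qed.

(** The tuple t is the barycenter of s followed by a tuple from a subdivided face. The clause on
    convex predicates also drives the induction: applied to a ball around the barycenter, it bounds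
    the new edges. *)
Lemma sd_shrink n (D : R) psi s : (size s <= n.+1)%N ->
  {in s &, forall p q, `|p.1 - q.1| <= D} -> sd barycenter psi s ->
  exists t, [/\ psi t, size t = size s,
    {in t &, forall p q, `|p.1 - q.1| <= n%:R / n.+1%:R * D} &
    forall C : V -> Prop, convex_pred C -> (forall p, p \in s -> C p.1) ->
      forall p, p \in t -> C p.1].
Proof.
have [k] := ubnP (size s); elim: k psi s => // k IH psi [|v s'] sk sn sD.
  by move=> ?; exists [::].
set s := v :: s' in sk sn sD *; have D0 : 0 <= D.
  by have := sD v v; rewrite subrr normr0 inE eqxx; apply.
rewrite sdE // => /cobd_ex[u [su szu us]].
have [|||t [pt szt tD tC]] := IH _ u _ _ _ su.
- by rewrite szu.
- by apply: ltnW; rewrite szu.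
- by move=> p q /us ps /us qs; apply: sD.
set b := barycenter s.
have bt p : p \in t -> `|b.1 - p.1| <= n%:R / n.+1%:R * D.
  move=> pt'; apply: (tC (fun x => `|b.1 - x| <= n%:R / n.+1%:R * D)) pt'.
  - move=> a x y /andP[a0 a1] hx hy.
    have -> : b.1 - (a *: x + (1 - a) *: y) = a *: (b.1 - x) + (1 - a) *: (b.1 - y).
      rewrite [in RHS]scalerBr [X in _ = _ + X]scalerBr addrACA.
      by rewrite -scalerDl (addrC a) subrK scale1r -opprD.
    apply: le_trans (ler_normD _ _) _; rewrite !normrZ !ger0_norm ?subr_ge0 //.
    set B := _ / _ * _ in hx hy *; have -> : B = a * B + (1 - a) * B by ring.
    by rewrite lerD // ler_wpM2l // subr_ge0.
  - move=> q /us qs; apply: barycenter_dist => // q' q's; exact: sD.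
exists (b :: t); split => //=; first by rewrite szt szu.
  move=> p q; rewrite !inE => /orP[/eqP->|pt1] /orP[/eqP->|qt1].
  - by rewrite subrr normr0 mulr_ge0 // divr_ge0.
  - exact: bt.
  - by rewrite distrC; exact: bt.
  - exact: tD.
move=> C cC Cs p; rewrite inE => /orP[/eqP ->|].
  exact: barycenter_convex.
by apply: tC => // q /us; apply: Cs.
Qed.

Lemma iter_sd_shrink n m (D : R) psi s : (size s <= n.+1)%N ->
  {in s &, forall p q, `|p.1 - q.1| <= D} -> iter m (sd barycenter) psi s ->
  exists t, [/\ psi t, size t = size s,
    {in t &, forall p q, `|p.1 - q.1| <= (n%:R / n.+1%:R) ^+ m * D} &
    forall C : V -> Prop, convex_pred C -> (forall p, p \in s -> C p.1) ->
      forall p, p \in t -> C p.1].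
Proof.
elim: m s D => [|m IH] s D sn sD.
  by move=> ps; exists s; split => // p q ps' qs; rewrite expr0 mul1r sD.
rewrite iterS => /(sd_shrink sn sD)[u [pu szu uD uC]].
have [|t [pt szt tD tC]] := IH u _ _ uD pu; first by rewrite szu.
exists t; split => //; first by rewrite szt.
  by move=> p q pt' qt; rewrite exprSr -mulrA tD.
by move=> C cC Cs; apply: tC => //; exact: uC.
Qed.

End Barycenter.

(** * Zeros of biskew maps *)

Section Orthants.
Context {R : realType} {n : nat}.
Implicit Types (e : 'I_n.+1 -> R) (x : 'rV[R]_n.+1) (X : seq 'rV[R]_n.+1).

Definition pole i : 'rV[R]_n.+1 := delta_mx 0 (inord i).

(** A convex set that avoids 0 and, for signs e, contains the face of the cross-polytope spanned by
    the first i + 1 signed unit vectors; the norm is the maximum norm. *)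
Definition in_face e i x :=
  [/\ \sum_l e l * x 0 l = 1, `|x| <= 1 & forall l : 'I_n.+1, (i < l)%N -> x 0 l = 0].

(* The condition e_i = 1 leaves room for one more pole at the front. *)
Definition hemispherical i X := exists e,
  [/\ forall l, `|e l| = 1, e (inord i) = 1 & forall x, x \in X -> in_face e i x].

Lemma in_face_pole e i : (i <= n)%N -> e (inord i) = 1 -> in_face e i (pole i).
Proof.
move=> ni ei; split.
- rewrite (bigD1 (inord i)) //= mxE !eqxx ei mulr1 big1 ?addr0 // => l li.
  by rewrite mxE (negbTE li) andbF mulr0.
- rewrite /normr /= mx_normrE; apply/bigmax_leP; split => // -[? l] _ /=.
  by rewrite mxE normr_nat; case: (_ && _).
- move=> l il; rewrite mxE; case: (l =P inord i) => [e'|_]; rewrite ?andbF //.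
  by move: il; rewrite e' inordK ?ltnn.
Qed.

Lemma in_face_convex e i : convex_pred (in_face e i).
Proof.
move=> a x y /andP[a0 a1] [sx x1 x0] [sy y1 y0].
have a'0 : 0 <= 1 - a by rewrite subr_ge0.
split.
- transitivity (a * \sum_l e l * x 0 l + (1 - a) * \sum_l e l * y 0 l).
    by rewrite !mulr_sumr -big_split; apply: eq_bigr => l _; rewrite !mxE /=; ring.
  by rewrite sx sy !mulr1 addrC subrK.
- apply: le_trans (ler_normD _ _) _; rewrite !normrZ !ger0_norm //.
  by have := ler_wpM2l a0 x1; have := ler_wpM2l a'0 y1; lra.
- by move=> l il; rewrite !mxE x0 // y0 // !mulr0 addr0.
Qed.

Lemma hemispherical_cons i X : (i <= n)%N -> hemispherical i X ->
  hemispherical i (pole i :: X).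
Proof.
move=> ni [e [e1 ei eX]]; exists e; split => // x; rewrite inE => /orP[/eqP ->|].
  exact: in_face_pole.
exact: eX.
Qed.

Lemma hemispherical_pole : hemispherical 0 [:: pole 0].
Proof.
exists (fun=> 1); split => // [l|x]; first by rewrite normr1.
by rewrite inE => /eqP ->; exact: in_face_pole.
Qed.

(** Coordinate i + 1 vanishes on X, so its sign can be reset to 1, as the new pole requires. *)
Lemma in_faceS e i X : (i < n)%N -> (forall l, `|e l| = 1) ->
  (forall x, x \in X -> in_face e i x) -> hemispherical i.+1 (pole i.+1 :: X).
Proof.
move=> ni e1 eX; exists (fun l => if l == inord i.+1 then 1 else e l).
split => [l||x]; rewrite ?eqxx //; first by case: eqP; rewrite ?normr1.
rewrite inE => /orP[/eqP ->|xX]; first by apply: in_face_pole; rewrite ?eqxx.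
have [s1 x1 x0] := eX _ xX; split => //; last by move=> l /ltnW; exact: x0.
rewrite -s1; apply: eq_bigr => l _; case: eqP => // ->.
by rewrite x0 ?mulr0 // inordK.
Qed.

Lemma hemisphericalS i X : (i < n)%N -> hemispherical i X ->
  hemispherical i.+1 (pole i.+1 :: X).
Proof. by move=> ni [e [e1 _ eX]]; exact: in_faceS eX. Qed.

Lemma hemisphericalNS i X : (i < n)%N -> hemispherical i X ->
  hemispherical i.+1 (pole i.+1 :: map -%R X).
Proof.
move=> ni [e [e1 _ eX]]; apply: (@in_faceS (fun l => - e l)) => // [l|_ /mapP[x xX ->]].
  by rewrite normrN.
have [s1 x1 x0] := eX _ xX; split; rewrite ?normrN //.
  by rewrite -s1; apply: eq_bigr => l _; rewrite mxE mulrNN.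
by move=> l il; rewrite mxE x0 ?oppr0.
Qed.

(** A compact set off 0 that contains all faces: 1 = |sum e_l x_l| <= (n + 1) |x| in the maximum
    norm. *)
Definition annulus := [set x : 'rV[R]_n.+1 | `|x| <= 1 /\ n.+1%:R^-1 <= `|x|].

Lemma in_face_annulus e i x : (forall l, `|e l| = 1) -> in_face e i x -> annulus x.
Proof.
move=> e1 [s1 x1 _]; split => //; rewrite -[_^-1]mul1r ler_pdivrMr ?ltr0n //.
rewrite -[leLHS](normr1 R) -[in leLHS]s1; apply: le_trans (ler_norm_sum _ _ _) _.
apply: (@le_trans _ _ (\sum_(l < n.+1) `|x|)).
  apply: ler_sum => l _; rewrite normrM e1 mul1r [leRHS]/normr /= mx_normrE.
  by apply: (le_bigmax _ (fun ij => `|x ij.1 ij.2|) (0, l)).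
by rewrite sumr_const card_ord mulr_natr.
Qed.

Lemma compact_annulus : compact annulus.
Proof.
apply: bounded_closed_compact.
  by exists 1; split => // M M1 x [x1 _] /=; exact: le_trans x1 (ltW M1).
have nc (D : set R) : closed D -> closed [set x : 'rV[R]_n.+1 | D `|x|].
  by apply: preimage_closed => x _; exact: norm_continuous.
have le1 : closed [set y : R | y <= 1] by exact: closed_le.
have ge : closed [set y : R | n.+1%:R^-1 <= y] by exact: closed_ge.
exact: closedI (nc _ le1) (nc _ ge).
Qed.

Lemma annulus_neq0 x : annulus x -> x != 0.
Proof.
by move=> [_]; apply: contraTN => /eqP ->; rewrite normr0 -ltNge invr_gt0 ltr0n.
Qed.

End Orthants.

(** * Existence of zeros by compactness *)

Section Biskew.
Context {R : realType} {r s : nat}.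
Local Notation V := ('rV[R]_r.+1 * 'rV[R]_s.+1)%type.

Theorem biskew_zero (F : nat -> V -> R) :
  (forall k x y, F k (- x, y) = - F k (x, y)) ->
  (forall k x y, F k (x, - y) = - F k (x, y)) ->
  (forall k x y, x != 0 -> y != 0 -> {for (x, y), continuous (F k)}) ->
  odd 'C(r + s, r) ->
  exists x y, [/\ x != 0, y != 0 & forall k, (k < r + s)%N -> F k (x, y) = 0].
Proof.
move=> F1 F2 Fc odC; pose A := annulus `*` annulus : set V.
pose q := (r + s)%:R / (r + s).+1%:R : R.
pose L1 (v : V) : V := (- v.1, v.2).
pose L2 (v : V) : V := (v.1, - v.2).
pose T1 (p : V * bool) := (L1 p.1, ~~ p.2).
pose T2 (p : V * bool) := (L2 p.1, ~~ p.2).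
pose b i j : V * bool := ((pole i, pole j), false).
pose g k (p : V * bool) := if F k p.1 == 0 then p.2 else 0 < F k p.1.
have T1K : involutive T1 by move=> [[x y] c]; rewrite /T1 /L1 /= opprK negbK.
have T2K : involutive T2 by move=> [[x y] c]; rewrite /T2 /L2 /= opprK negbK.
have gN k c v w : F k w = - F k v -> g k (w, ~~ c) = ~~ g k (v, c).
  by rewrite /g /= => ->; rewrite oppr_eq0 oppr_gt0; case: (ltgtP (F k v) 0).
have g1 k p : g k (T1 p) = ~~ g k p by case: p => [[x y] c]; apply: gN; exact: F1.
have g2 k p : g k (T2 p) = ~~ g k p by case: p => [[x y] c]; apply: gN; exact: F2.
have bar1 t : t != [::] -> barycenter (map T1 t) = T1 (barycenter t).
  apply: barycenter_map; first by rewrite /L1 /= oppr0.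
    by move=> [x y] [x' y']; rewrite /L1 /= opprD.
  by move=> a [x y]; rewrite /L1 /= -scalerN.
have bar2 t : t != [::] -> barycenter (map T2 t) = T2 (barycenter t).
  apply: barycenter_map; first by rewrite /L2 /= oppr0.
    by move=> [x y] [x' y']; rewrite /L2 /= opprD.
  by move=> a [x y]; rewrite /L2 /= -scalerN.
(* [cell_ex] wants the invariant for all i and j, but [pole] is meaningful only up to r and s, hence
   the conditions. *)
pose G i j (t : seq (V * bool)) := size t = (i + j).+1 /\
  ((i <= r)%N -> hemispherical i [seq p.1.1 | p <- t]) /\
  ((j <= s)%N -> hemispherical j [seq p.1.2 | p <- t]).
(* A simplex of the m-th subdivision of E_rs on which every coordinate of F changes sign weakly: v
   is any vertex, u and w depend on k. The initial diameter is at most 2, and q is the shrinking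
   factor for r + s + 1 vertices. *)
have approx m : exists v, A v /\ forall k, (k < r + s)%N -> exists u w,
    [/\ `|v - u| <= q ^+ m * 2, `|v - w| <= q ^+ m * 2 & F k u * F k w <= 0].
  have := cell_cup b T1K T2K (fun=> erefl) bar1 bar2 g1 g2 m r s.
  rewrite odC => /(@cell_ex _ b T1 T2 G)[].
  - by split => //; split => _; exact: hemispherical_pole.
  - move=> i j t [szt [ti tj]]; split; (split; first by rewrite /= ?size_map szt).
      split=> h /=; first by apply: hemisphericalS => //; apply/ti/ltnW.
      by apply: hemispherical_cons => //; exact: tj.
    split=> h /=; rewrite -map_comp.
      rewrite (map_comp -%R); apply: hemisphericalNS => //; exact/ti/ltnW.
    by apply: hemispherical_cons => //; exact: tj.
  - move=> i j t [szt [ti tj]]; split; (split; first by rewrite /= ?size_map szt addnS).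
      split=> h /=; last by apply: hemisphericalS => //; apply/tj/ltnW.
      by apply: hemispherical_cons => //; exact: ti.
    split=> h /=; rewrite -map_comp.
      by apply: hemispherical_cons => //; exact: ti.
    rewrite (map_comp -%R); apply: hemisphericalNS => //; exact/tj/ltnW.
  move=> t [szt [/(_ (leqnn _))[e [e1 _ et]] /(_ (leqnn _))[e' [e'1 _ e't]]]].
  have tx p : p \in t -> in_face e r p.1.1 by move=> pt; apply/et/map_f.
  have ty p : p \in t -> in_face e' s p.1.2.
    by move=> pt; apply: e't; apply: (map_f (fun p : V * bool => p.1.2)).
  have t2 : {in t &, forall p p', `|p.1 - p'.1| <= 2}.
    move=> p p' pt p't.
    have [[_ x1 _] [_ x'1 _]] := (tx _ pt, tx _ p't).
    have [[_ y1 _] [_ y'1 _]] := (ty _ pt, ty _ p't).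
    rewrite prod_normE /= ge_max; apply/andP; split.
      by apply: le_trans (ler_normB _ _) _; lra.
    by apply: le_trans (ler_normB _ _) _; lra.
  move=> /(iter_sd_shrink (n := r + s) _ t2)[|u [cu szu uD uC]]; first by rewrite szt.
  have uA p : p \in u -> A p.1.
    move=> pu; split => /=.
      apply: (in_face_annulus e1) (uC (fun v => in_face e r v.1) _ tx _ pu).
      by move=> a x y a01; exact: in_face_convex.
    apply: (in_face_annulus e'1) (uC (fun v => in_face e' s v.2) _ ty _ pu).
    by move=> a x y a01; exact: in_face_convex.
  have [p pu] : exists p, p \in u.
    by case: (u) szu => [|p ? _]; [rewrite szt|exists p; rewrite inE eqxx].
  exists p.1; split => [|k kN]; first exact: uA.
  have [p1 [p2 [p1u p2u]]] := cup_change cu kN.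
  rewrite /g => gne; exists p1.1, p2.1; split; [exact: uD|exact: uD|].
  move: gne; case: (ltgtP (F k p1.1) 0) => [h1|h1|->];
    case: (ltgtP (F k p2.1) 0) => [h2|h2|->]; rewrite ?mulr0 ?mul0r // => _.
    by rewrite nmulr_rle0 ?ltW.
  by rewrite pmulr_rle0 ?ltW.
have [v vP] := choice approx.
have [c [Ac clc]] : A `&` cluster (v @ \oo) !=set0.
  apply: compact_setX; [exact: compact_annulus|exact: compact_annulus|].
  by exists 0%N => // m _; exact: (vP m).1.
have [c1 c2] := Ac; exists c.1, c.2.
split; [exact: annulus_neq0|exact: annulus_neq0|move=> k kN].
apply/eqP/negPn/negP; rewrite -surjective_pairing => Fk0.
have Fkc : {for c, continuous (F k)}.
  by rewrite [c]surjective_pairing; apply: Fc; exact: annulus_neq0.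
(* If F_k(c) were nonzero, F_k would keep its sign near c, while the pairs u, w of [approx] come
   arbitrarily close to c. *)
have : \forall u \near c, 0 < F k u * F k c.
  have : {for c, continuous (fun u => F k u * F k c)}.
    by apply: cvgM => //; exact: cvg_cst.
  move/(@cvgr_gt _ _ _ _ _ _); apply.
  by rewrite -expr2 exprn_even_gt0.
move=> /nbhs_ballP[d /= d0 dP].
have q0 : 0 <= q by rewrite divr_ge0.
have : (fun m => q ^+ m * 2) @ \oo --> (0 : R).
  rewrite -[X in _ --> X](mul0r 2); apply: cvgM; last exact: cvg_cst.
  by apply: cvg_expr; rewrite ger0_norm // ltr_pdivrMr ?ltr0n // mul1r ltr_nat.
move=> /cvgr_lt /(_ (d / 2)); rewrite divr_gt0 // => /(_ isT)[M _ MP].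
have vM : (v @ \oo) (v @` [set m | (M <= m)%N]) by exists M => // m Mm; exists m.
have /(clc _ _ vM)[w [[m /= Mm <-] cw]] : nbhs c (ball c (d / 2)).
  by apply: nbhsx_ballx; rewrite divr_gt0.
have [_ /(_ _ kN)[u [u' [vu vu' uu']]]] := vP m.
have dF z : `|v m - z| <= q ^+ m * 2 -> 0 < F k z * F k c.
  move=> vz; apply: dP; rewrite -ball_normE /=; move: cw; rewrite -ball_normE /= => cw.
  rewrite (splitr d) -(subrK (v m) c) -addrA; apply: le_lt_trans (ler_normD _ _) _.
  by apply: ltrD => //; apply: le_lt_trans vz (MP _ Mm).
have := mulr_gt0 (dF _ vu) (dF _ vu').
have Fc2 : 0 < F k c * F k c by rewrite -expr2 exprn_even_gt0.
by rewrite mulrACA (pmulr_lgt0 _ Fc2) ltNge uu'.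
Qed.

End Biskew.

Lemma cvg_rV (R : realType) (n : nat) (T : Type) (F : set_system T) (FF : Filter F)
    (h : T -> 'rV[R]_n) (l : 'rV[R]_n) :
  (forall i, h t 0 i @[t --> F] --> l 0 i) -> h @ F --> l.
Proof.
move=> hl; apply/cvgrPdist_lt => e e0.
have : \forall t \near F, forall i : 'I_n, `|l 0 i - h t 0 i| < e.
  by apply: filter_forall => k; move/cvgrPdist_lt: (hl k); apply.
apply: filterS => t ht; rewrite [ltLHS]/normr /= mx_normrE.
by apply/bigmax_ltP; split => // -[j i] _ /=; rewrite ord1 !mxE.
Qed.

Section BiskewVector.
Context {R : realType} {r s : nat}.
Local Notation V := ('rV[R]_r.+1 * 'rV[R]_s.+1)%type.

Corollary biskew_zero_rV (F : V -> 'rV[R]_(r + s)) :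
  (forall x y, F (- x, y) = - F (x, y)) ->
  (forall x y, F (x, - y) = - F (x, y)) ->
  continuous F -> odd 'C(r + s, r) ->
  exists x y, [/\ x != 0, y != 0 & F (x, y) = 0].
Proof.
move=> F1 F2 Fc odC; pose G k p := if insub k is Some i then F p 0 i else 0.
have [||k x y _ _|//|x [y [x0 y0 Gxy]]] := @biskew_zero _ _ _ G.
- by move=> k x y; rewrite /G F1; case: insub => [i|]; rewrite ?mxE ?oppr0.
- by move=> k x y; rewrite /G F2; case: insub => [i|]; rewrite ?mxE ?oppr0.
- rewrite /G; case: insub => [i|]; last exact: cst_continuous.
  by apply: (@continuous_comp _ _ _ F (fun M => M 0 i)); [exact: Fc|exact: coord_continuous].
exists x, y; split => //; apply/rowP => i; rewrite mxE.
by have := Gxy i (ltn_ord i); rewrite /G valK.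
Qed.

End BiskewVector.

(** * Trapezoids *)

Section Coupled.
Context {R : realType} {d n : nat}.
Variable f : 'rV[R]_d -> 'rV[R]_n.
Hypothesis f_inj : injective f.
Hypothesis no_line : ~ maps_three_points_to_line f.
Hypothesis no_trapezoid : ~ inscribes_trapezoid f.

Lemma collinear_chord (a b c : 'rV[R]_n) t : a != b -> c - a = t *: (b - a) ->
  collinear a b c.
Proof.
move=> ab ca; exists [set a + t *: (b - a) | t in [set: R]]; split.
  by exists a, (b - a); split => //; rewrite subr_eq0 eq_sym.
by split; [exists 0|exists 1|exists t] => //;
  rewrite ?scale0r ?addr0 ?scale1r -?ca // addrC subrK.
Qed.

Lemma not_collinear x y z : uniq [:: x; y; z] -> ~ collinear (f x) (f y) (f z).
Proof. by move=> u c; apply: no_line; exists x, y, z. Qed.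

Lemma shared_endpoint x y z t : uniq [:: x; y; z] ->
  f x - f y <> t *: (f x - f z).
Proof.
move=> u e; have u' : uniq [:: x; z; y].
  by rewrite (perm_uniq (_ : perm_eq _ [:: x; y; z])) // perm_cons (perm_catC [:: z]).
apply: (not_collinear u'); apply: (@collinear_chord _ _ _ t).
  by rewrite (inj_eq f_inj); move: u'; rewrite /= inE negb_or => /andP[/andP[]].
by rewrite -opprB e -scalerN opprB.
Qed.

Lemma disjoint_chords x y x' y' t : uniq [:: x; y; x'; y'] -> 0 < t ->
  f x - f y <> t *: (f x' - f y').
Proof.
move=> u t0 e; apply: no_trapezoid; exists (f x), (f y), (f x'), (f y').
split; first by split; eexists.
split; first by rewrite (map_inj_uniq f_inj [:: x; y; x'; y']).
  move: u; rewrite /= !inE !negb_or => /and4P[/and3P[h1 h2 h3] /andP[h4 h5] h6 _].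
  by split; apply: not_collinear; rewrite /= !inE !negb_or ?h1 ?h2 ?h3 ?h4 ?h5 ?h6.
by exists 1, t; rewrite scale1r.
Qed.

(** Dependent chords are parallel with a nonzero ratio t. If they share one endpoint, three image
    points are collinear; if none, they span a trapezoid, after swapping x' and y' when t < 0. *)
Lemma coupled x y x' y' (a b : R) : x != y -> x' != y' -> (a != 0) || (b != 0) ->
  a *: (f x - f y) + b *: (f x' - f y') = 0 ->
  (x = x' /\ y = y') \/ (x = y' /\ y = x').
Proof.
move=> xy x'y' ab0 e.
have fxy : f x - f y != 0 by rewrite subr_eq0 (inj_eq f_inj).
have fx'y' : f x' - f y' != 0 by rewrite subr_eq0 (inj_eq f_inj).
have a0 : a != 0.
  apply: contraTneq ab0 => a0; move/eqP: e.
  by rewrite a0 scale0r add0r scaler_eq0 (negbTE fx'y') orbF eqxx => ->.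
pose t := - (a^-1 * b).
have {}e : f x - f y = t *: (f x' - f y').
  move/eqP: e; rewrite addr_eq0 => /eqP /(congr1 ( *:%R a^-1)).
  by rewrite scalerA mulVf // scale1r scalerN scalerA scaleNr.
clearbody t; have t0 : t != 0 by apply: contraNneq fxy => t0; rewrite e t0 scale0r.
have [xx'|xx'] := eqVneq x x'.
  have [yy'|yy'] := eqVneq y y'; first by left.
  subst x'; case: (@shared_endpoint x y y' t) => //.
  by rewrite /= !inE !negb_or xy x'y' yy'.
have [xy2|xy2] := eqVneq x y'.
  have [yx'|yx'] := eqVneq y x'; first by right.
  subst y'; case: (@shared_endpoint x y x' (- t)).
    by rewrite /= !inE !negb_or xy xx' yx'.
  by rewrite e scaleNr -scalerN opprB.
have [yx'|yx'] := eqVneq y x'.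
  subst x'; case: (@shared_endpoint y x y' (- t)).
    by rewrite /= !inE !negb_or eq_sym xy x'y' xy2.
  by rewrite -opprB e scaleNr.
have [yy'|yy'] := eqVneq y y'.
  subst y'; case: (@shared_endpoint y x x' t).
    by rewrite /= !inE !negb_or eq_sym xy xx' yx'.
  by rewrite -opprB e -scalerN opprB.
case: (ltgtP t 0) t0 => // tn _.
  case: (@disjoint_chords x y y' x' (- t)); rewrite ?oppr_gt0 //.
    by rewrite /= !inE !negb_or xy xx' xy2 yx' yy' eq_sym x'y'.
  by rewrite e scaleNr -scalerN opprB.
case: (@disjoint_chords x y x' y' t) => //.
by rewrite /= !inE !negb_or xy xx' xy2 yx' yy' x'y'.
Qed.

End Coupled.

(** * Complex, quaternion and octonion multiplication *)

(* With basis e_0, .., e_7 of the octonions, e_i * e_(i xor j) is - e_j or e_j. The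
   upper left 4x4 and 2x2 blocks give the quaternions and the complex numbers. *)
Definition octonion_sign i j := nth false (nth [::]
  [:: [:: false; false; false; false; false; false; false; false];
      [:: true; false; true; false; true; false; false; true];
      [:: true; false; false; true; true; true; false; false];
      [:: true; true; false; false; true; false; true; false];
      [:: true; false; false; false; false; true; true; true];
      [:: true; true; false; true; false; false; false; true];
      [:: true; true; true; false; false; true; false; false];
      [:: true; false; true; true; false; false; true; false]] i) j.

(** The j-th coordinate of the product v w. *)
Definition hurwitz_coord (R : pzRingType) d (v w : nat -> R) j :=
  \sum_(0 <= i < d) (-1) ^+ octonion_sign i j * v i * w (Nat.lxor i j).

Definition sum_squares (R : pzRingType) d (v : nat -> R) := \sum_(0 <= i < d) v i ^+ 2.

(** The two, four and eight square identities, checked as polynomial identities. *)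
Lemma hurwitz_identity (R : comPzRingType) d (v w : nat -> R) : d \in [:: 2; 4; 8]%N ->
  sum_squares d (hurwitz_coord d v w) = sum_squares d v * sum_squares d w.
Proof.
rewrite /sum_squares /hurwitz_coord !inE => /or3P[] /eqP ->; rewrite unlock /=; ring.
Qed.

(** e_0 is a left unit. *)
Lemma hurwitz_coord_shift (R : comPzRingType) d (v w : nat -> R) c j :
  d \in [:: 2; 4; 8]%N -> (j < d)%N ->
  hurwitz_coord d (fun k => v k - c *+ (k == 0%N)) w j = hurwitz_coord d v w j - c * w j.
Proof.
rewrite /hurwitz_coord !inE => /or3P[] /eqP ->;
  do 8! (case: j => [|j]; first by move=> _; rewrite unlock /=; ring) => //.
Qed.

Lemma sum_squares_eq0 (R : realDomainType) d (v : nat -> R) :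
  sum_squares d v = 0 -> forall k, (k < d)%N -> v k = 0.
Proof.
rewrite /sum_squares big_mkord => /eqP; rewrite psumr_eq0 => [|i _]; last exact: sqr_ge0.
move=> /allP /= h k kd; apply/eqP; rewrite -sqrf_eq0; apply: (h (Ordinal kd)).
by rewrite mem_index_enum.
Qed.

(** Here (v - c e_0) w = 0, and the norm is multiplicative, so one factor vanishes. *)
Lemma hurwitz_coord_inj (R : realDomainType) d (v w : nat -> R) c :
  d \in [:: 2; 4; 8]%N -> (forall j, (j < d)%N -> hurwitz_coord d v w j = c * w j) ->
  (forall k, (k < d)%N -> v k = c *+ (k == 0%N)) \/ (forall k, (k < d)%N -> w k = 0).
Proof.
move=> d248 e; have := hurwitz_identity (fun k => v k - c *+ (k == 0%N)) w d248.
rewrite [LHS]/sum_squares big_nat_cond big1 => [/esym/eqP|j /andP[/andP[_ jd] _]].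
  rewrite mulf_eq0 => /orP[]/eqP/sum_squares_eq0 h; [left|by right].
  by move=> k /h /eqP; rewrite subr_eq0 => /eqP.
by rewrite hurwitz_coord_shift // e // subrr expr0n.
Qed.

Section Hurwitz.
Context {R : realType} {d' : nat}.
Local Notation d := d'.+1.
Implicit Types v w : 'rV[R]_d.

Definition hurwitz v w : 'rV[R]_d :=
  \row_j hurwitz_coord d (fun k => v 0 (inord k)) (fun k => w 0 (inord k)) j.

Lemma hurwitzNl v w : hurwitz (- v) w = - hurwitz v w.
Proof.
apply/rowP => j; rewrite !mxE /hurwitz_coord -sumrN; apply: eq_bigr => i _.
by rewrite mxE mulrN mulNr.
Qed.

Lemma hurwitzNr v w : hurwitz v (- w) = - hurwitz v w.
Proof.
apply/rowP => j; rewrite !mxE /hurwitz_coord -sumrN; apply: eq_bigr => i _.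
by rewrite mxE mulrN.
Qed.

Lemma hurwitz_scale_inj v w c : d \in [:: 2; 4; 8]%N -> w != 0 ->
  hurwitz v w = c *: w -> v = c *: delta_mx 0 0.
Proof.
move=> d248 w0 e.
have [j jd||h] := @hurwitz_coord_inj R d (fun k => v 0 (inord k))
  (fun k => w 0 (inord k)) c d248.
- have /rowP/(_ (inord j)) := e; rewrite !mxE inordK //.
- move=> h; apply/rowP => k; rewrite !mxE /= -[k in LHS]inord_val h //.
  by rewrite mulr_natr.
case/eqP: w0; apply/rowP => k; rewrite mxE -[k]inord_val h //.
Qed.

Lemma cvg_hurwitz (T : Type) (F : set_system T) (FF : Filter F) (a b : T -> 'rV[R]_d) v w :
  a @ F --> v -> b @ F --> w -> hurwitz (a t) (b t) @[t --> F] --> hurwitz v w.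
Proof.
move=> av bw.
have cc (h : T -> 'rV[R]_d) (x : 'rV[R]_d) i : h @ F --> x -> h t 0 i @[t --> F] --> x 0 i.
  move=> hx; apply: (@cvg_comp _ _ _ h (fun M : 'rV[R]_d => M 0 i) _ _ _ hx).
  exact: coord_continuous.
apply: cvg_rV => j; under eq_cvg do rewrite mxE; rewrite mxE.
apply: cvg_big => [|i _]; first exact: add_continuous.
by apply: cvgM; [apply: cvgM; [exact: cvg_cst|exact: cc]|exact: cc].
Qed.

End Hurwitz.

(** * The biskew map attached to f *)

Section MainArgument.
Context {R : realType} {d' : nat}.
Local Notation d := d'.+1.
Local Notation N := ((d + d) + d')%N.
Hypothesis d248 : d \in [:: 2; 4; 8]%N.
Hypothesis odC : odd 'C(N, d + d).
Variable f : 'rV[R]_d -> 'rV[R]_N.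

Theorem trapezoid_or_line : embedding f ->
  inscribes_trapezoid f \/ maps_three_points_to_line f.
Proof.
move=> [fc fi _]; apply: contrapT => /not_orP[notrap noline].
have cpl := coupled fi noline notrap.
pose aa (x : 'rV[R]_(1 + (d + d))) : R := x 0 0.
pose uu (x : 'rV[R]_(1 + (d + d))) : 'rV[R]_d := lsubmx (rsubmx x).
pose vv (x : 'rV[R]_(1 + (d + d))) : 'rV[R]_d := rsubmx (rsubmx x).
(* Even in x and larger than |Re v|: if lam w + v w = 0 with w nonzero, then v = - lam e_0, which is
   impossible. *)
pose lam x := 1 + `|vv x 0 0|.
pose D x w := lam x *: w + hurwitz (vv x) w.
pose g c D := f (c + D) - f (c - D).
pose G x w := g (uu x) (D x w).
(* [G x w] and [G (- x) w] are G+ and G-. Replacing x by - x swaps them and negates a, so this is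
   odd; it equals (a + 1) G+ + (a - 1) G-, whose coefficients never vanish together. *)
pose Phi (p : 'rV[R]_(d + d).+1 * 'rV[R]_d) :=
  aa p.1 *: (G p.1 p.2 + G (- p.1) p.2) + (G p.1 p.2 - G (- p.1) p.2).
have aaN x : aa (- x) = - aa x by rewrite /aa mxE.
have uuN x : uu (- x) = - uu x by apply/rowP => i; rewrite !mxE.
have vvN x : vv (- x) = - vv x by apply/rowP => i; rewrite !mxE.
have lamN x : lam (- x) = lam x by rewrite /lam vvN mxE normrN.
have DNr x w : D x (- w) = - D x w by rewrite /D hurwitzNr scalerN opprD.
have gN c e : g c (- e) = - g c e by rewrite /g opprK opprB.
have lam0 x : 0 < lam x by rewrite /lam ltr_wpDr.
have D0 x w : w != 0 -> D x w != 0.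
  move=> w0; apply/eqP; rewrite /D addrC => /eqP; rewrite addr_eq0 -scaleNr => /eqP.
  move/(hurwitz_scale_inj d248 w0)/rowP/(_ 0).
  rewrite [RHS]mxE [delta_mx _ _ _ _]mxE /= mulr1 => e.
  have := lam0 x; rewrite -oppr_lt0 -e => vn.
  by move: e; rewrite /lam ltr0_norm //; lra.
have rowc (h : 'rV[R]_(d + d).+1 -> 'rV[R]_d) (k : 'I_d -> 'I_(d + d).+1) :
    (forall x i, h x 0 i = x 0 (k i)) ->
    forall p : 'rV[R]_(d + d).+1 * 'rV[R]_d, h q.1 @[q --> p] --> h p.1.
  move=> hk p; apply: cvg_rV => i; rewrite hk; under eq_cvg do rewrite hk.
  apply: (@cvg_comp _ _ _ fst (fun x : 'rV[R]_(d + d).+1 => x 0 (k i))).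
    exact: cvg_fst.
  exact: coord_continuous.
have uc (p : 'rV[R]_(d + d).+1 * 'rV[R]_d) : uu q.1 @[q --> p] --> uu p.1.
  by apply: (rowc uu (fun i => rshift 1 (lshift d i))) => x i; rewrite !mxE.
have vc (p : 'rV[R]_(d + d).+1 * 'rV[R]_d) : vv q.1 @[q --> p] --> vv p.1.
  by apply: (rowc vv (fun i => rshift 1 (rshift d i))) => x i; rewrite !mxE.
have wc (p : 'rV[R]_(d + d).+1 * 'rV[R]_d) : q.2 @[q --> p] --> p.2.
  exact: cvg_snd.
have Dc (p : 'rV[R]_(d + d).+1 * 'rV[R]_d) : D q.1 q.2 @[q --> p] --> D p.1 p.2.
  apply: cvgD; last by apply: cvg_hurwitz; [exact: vc|exact: wc].
  apply: cvgZ; last exact: wc.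
  apply: cvgD; first exact: cvg_cst.
  apply: cvg_norm; apply: (@cvg_comp _ _ _ _ (fun M : 'rV[R]_d => M 0 0) _ _ _ (vc p)).
  exact: coord_continuous.
have Gc (p : 'rV[R]_(d + d).+1 * 'rV[R]_d) : G q.1 q.2 @[q --> p] --> G p.1 p.2.
  by apply: cvgB; (apply: continuous_cvg; first exact: fc);
    [apply: cvgD; [exact: uc|exact: Dc]|apply: cvgB; [exact: uc|exact: Dc]].
have GNc (p : 'rV[R]_(d + d).+1 * 'rV[R]_d) : G (- q.1) q.2 @[q --> p] --> G (- p.1) p.2.
  have Nc : (- q.1, q.2) @[q --> p] --> (- p.1, p.2).
    have N1 : - q.1 @[q --> p] --> - p.1 by apply: cvgN; exact: cvg_fst.
    exact: cvg_pair N1 (wc p).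
  exact: cvg_comp Nc (Gc (- p.1, p.2)).
have coord0 x : aa x = 0 -> uu x = 0 -> vv x = 0 -> x = 0.
  move=> a0 u0 v0; rewrite -[x]hsubmxK -[rsubmx x]hsubmxK -/(uu x) -/(vv x) u0 v0.
  rewrite row_mx0; have -> : lsubmx x = 0; last by rewrite row_mx0.
  by apply/rowP => i; rewrite ord1 !mxE -[RHS]a0; congr (x _ _); apply: val_inj.
have ab0 (a : R) : (a + 1 != 0) || (a - 1 != 0).
  by rewrite -negb_and; apply/negP => /andP[/eqP h1 /eqP h2]; lra.
have chord_eq (u D1 D2 : 'rV[R]_d) : u + D1 = - u + D2 -> u - D1 = - u - D2 ->
    u = 0 /\ D1 = D2.
  move=> /rowP e1 /rowP e2; split; apply/rowP => i;
    by move: (e1 i) (e2 i); rewrite !mxE; lra.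
have [|||x [w [x0 w0 Phi0]]] := @biskew_zero_rV R (d + d) d' Phi _ _ _ odC.
- move=> x w; rewrite /Phi /= aaN opprK (addrC (G (- x) w)).
  rewrite scaleNr [RHS]opprD; congr (_ + _); exact/esym/opprB.
- move=> x w; rewrite /Phi /G /= !DNr !gN.
  have alt (a : R) (A B : 'rV[R]_N) :
    a *: (- A - B) + (- A - - B) = - (a *: (A + B) + (A - B)).
    by rewrite -!opprD scalerN -opprD.
  exact: alt.
- move=> p; apply: cvgD; last by apply: cvgB; [exact: Gc|exact: GNc].
  apply: cvgZ; last by apply: cvgD; [exact: Gc|exact: GNc].
  apply: (@cvg_comp _ _ _ fst (fun x : 'rV[R]_(d + d).+1 => x 0 0)).
    exact: cvg_fst.
  exact: coord_continuous.
have twice (V : lmodType R) (z : V) : z = - z -> z = 0.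
  move/eqP; rewrite -subr_eq0 opprK -mulr2n -scaler_nat scaler_eq0 pnatr_eq0 /=.
  by move/eqP.
have ne c e : e != 0 -> c + e != c - e :> 'rV[R]_d.
  by apply: contra_neq => /addrI /twice.
have := cpl _ _ _ _ _ _ (ne (uu x) _ (D0 x w w0)) (ne (uu (- x)) _ (D0 (- x) w w0))
  (ab0 (aa x)).
case=> [|[]|[]].
- rewrite -[RHS]Phi0 /Phi /=.
  have alt (a : R) (A B : 'rV[R]_N) :
    (a + 1) *: A + (a - 1) *: B = a *: (A + B) + (A - B).
    by rewrite scalerDl scalerBl scalerDr !scale1r addrACA.
  exact: alt.
(* Same order of endpoints: u = 0 and v w = 0, so v = 0 and a is nonzero. Then Phi = 2 a G+ with G+
   nonzero by injectivity of f. *)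
- rewrite uuN => /chord_eq e /e[u0 DD].
  have hw0 : hurwitz (vv x) w = 0.
    by apply: twice; move: DD; rewrite /D lamN vvN hurwitzNl => /addrI.
  have v0 : vv x = 0.
    by rewrite (@hurwitz_scale_inj _ _ (vv x) w 0 d248 w0) ?scale0r // hw0.
  have a0 : aa x != 0 by apply: contraNneq x0 => a0; apply/eqP/coord0.
  move: Phi0; rewrite /Phi /= /G uuN -DD u0 oppr0 subrr addr0 -mulr2n => /eqP.
  rewrite -scaler_nat !scaler_eq0 (negbTE a0) pnatr_eq0 /= /g !add0r subr_eq0.
  move=> /eqP /fi /twice /eqP; exact/negP/D0.
(* Opposite order of endpoints: lam w + v w = - (lam w - v w) gives lam w = 0, impossible. *)
- rewrite uuN => e1 e2.
  have /chord_eq e : uu x + D x w = - uu x + - D (- x) w by [].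
  have [_] : uu x = 0 /\ D x w = - D (- x) w by apply: e; rewrite opprK.
  rewrite /D lamN vvN hurwitzNl opprB addrC => /addrI /twice /eqP.
  by rewrite scaler_eq0 (negbTE w0) orbF gt_eqF.
Qed.
End MainArgument.

Theorem corollary2 (R : realType) :
  [/\ forall f : 'rV[R]_2 -> 'rV[R]_5,
        embedding f -> inscribes_trapezoid f \/ maps_three_points_to_line f,
      forall f : 'rV[R]_4 -> 'rV[R]_11,
        embedding f -> inscribes_trapezoid f \/ maps_three_points_to_line f &
      forall f : 'rV[R]_8 -> 'rV[R]_23,
        embedding f -> inscribes_trapezoid f \/ maps_three_points_to_line f].
Proof.
split=> f.
(* The argument is d - 1. For d = 2 and 4, 'C(5, 4) = 5 and 'C(11, 8) = 165 are odd by
   evaluation. *)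
- exact: (@trapezoid_or_line R 1).
- exact: (@trapezoid_or_line R 3).
- exact: (@trapezoid_or_line R 7 isT odd_bin_23_16).
Qed.
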